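(* Consider the initial-value problem $$\rho_t+v\rho_x+\rho v_x=0,\qquad v_t+vv_x=-\omega(v-v^* ),\qquad t\ge 0,\ x\in\mathbb{R},$$ $$\rho(0,x)=\rho_0(x),\qquad v(0,x)=v_0(x),\qquad x\in\mathbb{R},$$ where $\omega=\mu+g(0)$, $\rho_0\in C^1(\mathbb{R})\cap W^{1,\infty}(\mathbb{R})$, $v_0\in C^2(\mathbb{R})\cap W^{2,\infty}(\mathbb{R})$ with $\inf_{x\in\mathbb{R}}v_0'(x)>-\omega$ and $\rho_0(x)>0$ for all $x\in\mathbb{R}$. Then this initial-value problem has a unique solution, and it satisfies the estimates $$\sup_{x\in\mathbb{R}}\rho(t,x)\le\frac{\omega\,\sup_{x\in\mathbb{R}}\rho_0(x)}{\omega+(1-\exp(-\omega t))\inf_{x\in\mathbb{R}}v_0'(x)}\quad\text{for all } t\ge 0,$$ $$\sup_{x\in\mathbb{R}}|v(t,x)-v^*|\le\exp(-\omega t)\sup_{x\in\mathbb{R}}|v_0(x)-v^*|\quad\text{for all } t\ge0,$$ $$\rho(t,x)>0\quad\text{for all } t\ge 0,\ x\in\mathbb{R}.$$ Moreover, there exists a function $h:\mathbb{R}\to(0,+\infty)$ of class $C^1(\mathbb{R})\cap L^\infty(\mathbb{R})$ for which $$\sup_{x\in\mathbb{R},\,t\ge0}\Big(|\rho(t,x)-h(x-v^*t)|\exp(\omega t)\Big)<+\infty.$$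
   Context: $\mu>0$ and $v_{\max}>v^*>0$ are constants. $f\in C^1(\mathbb{R})$ is a non-decreasing function with $\max(x,0)\le f(x)$ for all $x\in\mathbb{R}$, and $$g(x)=\frac{v_{\max}f(x)}{v^*(v_{\max}-v^* )}-\frac{x}{v^*},\quad x\in\mathbb{R}.$$ $W^{k,\infty}(\mathbb{R})$ denotes the Sobolev space of $L^\infty(\mathbb{R})$ functions with weak derivatives of order $\le k$ all in $L^\infty(\mathbb{R})$. Subscripts $t,x$ denote partial derivatives. Solutions are classical: $\rho,v$ are $C^1$ functions on $[0,+\infty)\times\mathbb{R}$ satisfying the equations pointwise. *)

(* Defs.v *)
From HB Require Import structures.
From mathcomp Require Import all_boot all_order all_algebra.
From mathcomp Require Import all_classical all_reals all_analysis.

Set Implicit Arguments.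
Unset Strict Implicit.
Unset Printing Implicit Defensive.

Import Order.TTheory GRing.Theory Num.Theory.
Import numFieldNormedType.Exports.

Local Open Scope ring_scope.
Local Open Scope classical_set_scope.


Definition class_C (R : realType) (k : nat) (u : R -> R) : Prop :=
  (forall j, (j < k)%N -> forall x, derivable u^`(j) x 1) /\
  (forall j, (j <= k)%N -> continuous u^`(j)).

Definition test_function (R : realType) (phi : R -> R) : Prop :=
  (forall k, class_C k phi) /\ compact (closure [set x | phi x != 0]).

Definition in_Linfty (R : realType) (u : R -> R) : Prop :=
  u \in Lfun (@lebesgue_measure R) +oo%E.

Definition is_weak_derivative (R : realType) (j : nat) (u w : R -> R) : Prop :=
  forall phi : R -> R, test_function phi ->
    \int[@lebesgue_measure R]_x (u x * (phi^`(j))%classic x) =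
    (-1) ^+ j * \int[@lebesgue_measure R]_x (w x * phi x).

Definition in_Winfty (R : realType) (k : nat) (u : R -> R) : Prop :=
  in_Linfty u /\
  forall j, (1 <= j <= k)%N ->
    exists2 w : R -> R, in_Linfty w & is_weak_derivative j u w.

Definition g (R : realType) (vmax vstar : R) (f : R -> R) (x : R) : R :=
  vmax * f x / (vstar * (vmax - vstar)) - x / vstar.

(* A function of (t, x) is written u t x and only its values at t >= 0 matter.
   Hence the t-derivative is the limit of difference quotients over times
   s >= 0: it is two-sided for t > 0 and one-sided at t = 0. *)
Definition dt_quotient (R : realType) (u : R -> R -> R) (t x : R) :=
  (fun s => (u s x - u t x) / (s - t)) @ within [set s : R | 0 <= s] t^'.

Definition dt (R : realType) (u : R -> R -> R) (t x : R) : R :=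
  lim (dt_quotient u t x).

Definition dx (R : realType) (u : R -> R -> R) (t x : R) : R := derive1 (u t) x.

Definition continuous_halfplane (R : realType) (u : R -> R -> R) : Prop :=
  {within [set p : R * R | 0 <= p.1], continuous (fun p => u p.1 p.2)}.

Definition class_C1_halfplane (R : realType) (u : R -> R -> R) : Prop :=
  [/\ continuous_halfplane u,
      forall t x, 0 <= t -> cvg (dt_quotient u t x) /\ derivable (u t) x 1,
      continuous_halfplane (dt u) &
      continuous_halfplane (dx u)].

Definition is_solution (R : realType) (omega vstar : R) (rho0 v0 : R -> R)
    (rho v : R -> R -> R) : Prop :=
  [/\ class_C1_halfplane rho, class_C1_halfplane v,
      forall t x, 0 <= t ->
        dt rho t x + v t x * dx rho t x + rho t x * dx v t x = 0,
      forall t x, 0 <= t ->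
        dt v t x + v t x * dx v t x = - omega * (v t x - vstar) &
      forall x, rho 0 x = rho0 x /\ v 0 x = v0 x].

(* Main.v *)
(** The velocity equation is a damped Burgers equation, so along the characteristic
    issued from [xi] the velocity is [vstar + exp(-omega t) u(xi)], where
    [u = v0 - vstar], and the characteristic is explicit:
    [X(t, xi) = xi + vstar t + a(t) u(xi)] with [a(t) = (1 - exp(-omega t)) / omega].
    As [inf v0' > -omega], the map [xi |-> xi + a u(xi)] has slope at least some [c > 0] for
    every [a] in [[0, 1/omega]]; let [Xi(a, y)] be its inverse.  Then
    [rho(t, x) = D(a(t), x - vstar t)] where
    [D(a, y) = rho0(Xi(a, y)) / (1 + a u'(Xi(a, y)))], and the profile is
    [h = D(1/omega, .)].  The rate of convergence is the Lipschitz continuity of [D] in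
    [a], because [1/omega - a(t) = exp(-omega t) / omega].  For uniqueness, the
    difference between any solution and the explicit one satisfies a linear
    homogeneous ODE along the explicit characteristics, which cover the half-plane.
    The bounds on [rho0'], [v0'] and [v0''] come from the weak derivatives: a
    continuous derivative is dominated by any [L^oo] bound of its weak version. *)

Require Import Defs.
From HB Require Import structures.
From mathcomp Require Import all_boot all_order all_algebra.
From mathcomp Require Import all_classical all_reals all_analysis.
From mathcomp Require Import ring lra measurable_realfun ess_sup_inf.

Set Implicit Arguments.
Unset Strict Implicit.
Unset Printing Implicit Defensive.

Import Order.TTheory GRing.Theory Num.Theory.
Import numFieldNormedType.Exports.

Local Open Scope ring_scope.
Local Open Scope classical_set_scope.

(** * Derivation rules for functions given pointwise *)

Section pointwise_derivation_rules.
Context {R : realType}.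
Implicit Types (f g : R -> R) (x a b c : R).

Lemma is_derive_fun_cst c x : is_derive x 1 (fun=> c) 0.
Proof. exact: is_derive_cst. Qed.

Lemma is_derive_fun_id x : is_derive x 1 (fun y : R => y) 1.
Proof. exact: is_derive_id. Qed.

Lemma is_derive_funD f g x a b : is_derive x 1 f a -> is_derive x 1 g b ->
  is_derive x 1 (fun y => f y + g y) (a + b).
Proof. by move=> df dg; exact: is_deriveD. Qed.

Lemma is_derive_funB f g x a b : is_derive x 1 f a -> is_derive x 1 g b ->
  is_derive x 1 (fun y => f y - g y) (a - b).
Proof. by move=> df dg; exact: is_deriveB. Qed.

Lemma is_derive_funM f g x a b : is_derive x 1 f a -> is_derive x 1 g b ->
  is_derive x 1 (fun y => f y * g y) (a * g x + f x * b).
Proof.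
move=> df dg; apply: (is_derive_eq (is_deriveM df dg)).
by rewrite /GRing.scale /= addrC mulrC.
Qed.

Lemma is_derive_funV f x a : is_derive x 1 f a -> f x != 0 ->
  is_derive x 1 (fun y => (f y)^-1) (- a / f x ^+ 2).
Proof.
move=> df fx0; apply: (is_derive_eq (is_deriveV fx0 df)).
by rewrite /GRing.scale /= mulNr mulrC mulNr mulrC.
Qed.

Lemma is_derive_fun_comp f g x a b : is_derive (g x) 1 f a -> is_derive x 1 g b ->
  is_derive x 1 (fun y => f (g y)) (a * b).
Proof. exact: is_derive1_comp. Qed.

Lemma is_derive_continuous f x a : is_derive x 1 f a -> {for x, continuous f}.
Proof. by move=> df; exact/differentiable_continuous/derivable1_diffP. Qed.

Lemma is_derive_derive1 f x a : is_derive x 1 f a -> f^`() x = a.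
Proof. by move=> df; rewrite derive1E; exact: derive_val. Qed.

End pointwise_derivation_rules.

(** * Smooth bump functions *)

(** The exponential beats every polynomial. A factor [y ^+ n] is carried through the induction on
    [p]: the summand [p * 'X] raises [n] by one, and the constant term uses [y^n <= n! exp(y)]. *)
Lemma horner_expRN_bounded (R : realType) (p : {poly R}) :
  exists C : R, forall y : R, 0 <= y -> `|p.[y]| * expR (- y) <= C.
Proof.
suff H : forall n : nat, exists C : R, forall y : R, 0 <= y ->
    `|p.[y]| * y ^+ n * expR (- y) <= C.
  by have [C HC] := H 0%N; exists C => y /HC; rewrite expr0 mulr1.
elim/poly_ind: p => [|p c IH] n.
  by exists 0 => y _; rewrite horner0 normr0 !mul0r.
have [C HC] := IH n.+1; exists (C + `|c| * (n`!)%:R) => y y0.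
have E0 : 0 <= expR (- y) := expR_ge0 _.
have En : y ^+ n * expR (- y) <= (n`!)%:R.
  rewrite expRN ler_pdivrMr ?expR_gt0//.
  case: n {HC} => [|n]; first by rewrite expr0 fact0 mul1r -expR0 ler_expR.
  rewrite mulrC -ler_pdivrMr ?ltr0n ?fact_gt0//.
  by apply: le_trans (expR_ge1Dxn n y0); rewrite lerDr.
apply: (@le_trans _ _ ((`|p.[y]| * y ^+ n.+1 + `|c| * y ^+ n) * expR (- y))).
  apply: ler_wpM2r => //; rewrite hornerMXaddC exprS mulrA -mulrDl.
  apply: ler_wpM2r; first exact: exprn_ge0.
  by apply: (le_trans (ler_normD _ _)); rewrite normrM (ger0_norm y0).
by rewrite mulrDl lerD ?HC// -mulrA ler_wpM2l.
Qed.

(** For [p = 1] this is the classical smooth function that is flat at the origin. The polynomial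
    factor makes the family stable under differentiation. *)
Definition flat (R : realType) (p : {poly R}) (x : R) : R :=
  if 0 < x then p.[x^-1] * expR (- x^-1) else 0.

Lemma flat_le0 (R : realType) (p : {poly R}) (x : R) : x <= 0 -> flat p x = 0.
Proof. by rewrite /flat; case: ltgtP. Qed.

Lemma flat_continuous0 (R : realType) (p : {poly R}) :
  {for 0, continuous (flat p)}.
Proof.
(* With [y = 1/x], a bound on [y p(y) exp(-y)] gives [|flat p x| <= C |x|]. *)
have [C HC] := horner_expRN_bounded (p * 'X).
have C0 : 0 <= C by apply: le_trans (HC 0 _) => //; rewrite mulr_ge0// expR_ge0.
have bound x : `|flat p x| <= C * `|x|.
  rewrite /flat; case: ifPn => [x0|_]; last by rewrite normr0 mulr_ge0.
  have := HC x^-1; rewrite invr_ge0 ltW// hornerMX normrM => /(_ isT).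
  rewrite normrM normfV (ger0_norm (expR_ge0 _)).
  by rewrite mulrAC ler_pdivrMr ?normr_gt0 ?gt_eqF.
apply/cvgrPdist_le => e e0; rewrite flat_le0//.
have C1 : 0 < C + 1 by rewrite ltr_wpDl.
have d0 : 0 < (C + 1)^-1 * e by rewrite mulr_gt0 ?invr_gt0.
apply: filterS (@nbhs0_le R R _ d0) => x.
rewrite ler_pdivlMl// sub0r normrN => /(le_trans _); apply.
by rewrite (le_trans (bound _))// ler_wpM2r// lerDl.
Qed.

(** For [x > 0] this is the chain rule with [y = 1/x], whose derivative is [- y^2]. At [0] the
    difference quotient of [flat p] is [flat ('X * p)], which is continuous there and vanishes. *)
Lemma is_derive_flat (R : realType) (p : {poly R}) (x : R) :
  is_derive x 1 (flat p) (flat ('X^2 * (p - p^`())) x).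
Proof.
have [x0|x0|->] := ltgtP x 0.
- rewrite flat_le0 ?ltW//.
  apply: (@near_eq_is_derive _ _ _ (cst 0)).
  near=> y; rewrite flat_le0// ltW//.
  by near: y; exact: lt_nbhsl.
- have xN0 : x != 0 by rewrite gt_eqF.
  have dV : is_derive x 1 (fun y : R => y^-1) (- x ^- 2).
    have := is_derive_funV (is_derive_fun_id x) xN0.
    by rewrite mulN1r.
  have dp := is_derive_fun_comp (is_derive_poly p _) dV.
  have de := is_derive_fun_comp (is_derive_expR _)
    (is_derive_funB (is_derive_fun_cst 0 x) dV).
  have dm : is_derive x 1 (fun y : R => p.[y^-1] * expR (0 - y^-1))
      (flat ('X^2 * (p - p^`())) x).
    apply: (is_derive_eq (is_derive_funM dp de)).
    rewrite /flat x0 hornerM hornerXn hornerD hornerN exprVn sub0r.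
    by ring.
  apply: near_eq_is_derive dm; near=> y; rewrite /flat ifT ?sub0r//.
  by near: y; exact: lt_nbhsr.
- rewrite flat_le0//; apply/is_derive1_caratheodory.
  exists (flat ('X * p)); split; [|exact: flat_continuous0|by rewrite flat_le0].
  move=> z; rewrite (flat_le0 _ (lexx 0)) !subr0 /flat.
  case: ifPn => [z0|]; last by rewrite mul0r.
  by rewrite hornerM hornerX; field; rewrite gt_eqF.
Unshelve. all: by end_near. Qed.

(** All iterated derivatives stay in [A], so each of them is differentiable and therefore
    continuous. *)
Lemma class_C_closed (R : realType) (A : set (R -> R)) (k : nat) (f : R -> R) :
  (forall u, A u -> exists2 u', A u' & forall x : R, is_derive x 1 u (u' x)) ->
  A f -> class_C k f.
Proof.
move=> Ader Af.
have derA u : A u -> A u^`() /\ forall x, derivable u x 1.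
  move=> /Ader[u' Au' uu']; suff -> : u^`() = u' by split=> // x; exact: ex_derive.
  by apply/funext => x; rewrite derive1E; exact: derive_val.
have An j : A f^`(j) by elim: j => [//|j IH]; rewrite derive1nS; exact: (derA _ IH).1.
split=> j _ x; first exact: (derA _ (An j)).2.
exact/differentiable_continuous/derivable1_diffP/(derA _ (An j)).2.
Qed.

(* Closed under differentiation, so that smoothness of its members follows without
   computing higher derivatives. *)
Inductive bump_family (R : realType) (a b : R) : (R -> R) -> Prop :=
| bump_prod (p q : {poly R}) : bump_family a b (fun x => flat p (x - a) * flat q (b - x))
| bump_add (u v : R -> R) : bump_family a b u -> bump_family a b v ->
    bump_family a b (u + v).

Lemma bump_family_derive (R : realType) (a b : R) (u : R -> R) :
  bump_family a b u ->
  exists2 u', bump_family a b u' & forall x : R, is_derive x 1 u (u' x).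
Proof.
elim=> [p q|{}u v _ [u' bu' du] _ [v' bv' dv]]; last first.
  by exists (u' + v'); [exact: bump_add|move=> x; exact: is_deriveD].
pose D (r : {poly R}) := 'X^2 * (r - r^`()).
(* Product rule; the sign in [- D q] is the inner derivative of [b - x]. *)
exists ((fun x => flat (D p) (x - a) * flat q (b - x)) +
        (fun x => flat p (x - a) * flat (- D q) (b - x))).
  by apply: bump_add; exact: bump_prod.
move=> x.
have da := is_derive_fun_comp (is_derive_flat p _)
  (is_derive_funB (is_derive_fun_id x) (is_derive_fun_cst a x)).
have db := is_derive_fun_comp (is_derive_flat q _)
  (is_derive_funB (is_derive_fun_cst b x) (is_derive_fun_id x)).
apply: (is_derive_eq (is_derive_funM da db)).
rewrite subr0 mulr1 sub0r mulrN1 -/(D p) -/(D q) /GRing.add/=; congr (_ + _ * _).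
by rewrite /flat hornerN mulNr; case: ifP => //; rewrite oppr0.
Qed.

Lemma bump_family_class_C (R : realType) (a b : R) (u : R -> R) (k : nat) :
  bump_family a b u -> class_C k u.
Proof. by apply: class_C_closed => v; exact: bump_family_derive. Qed.

Lemma bump_family_derive1 (R : realType) (a b : R) (u : R -> R) :
  bump_family a b u -> bump_family a b u^`().
Proof.
move=> /bump_family_derive[u' bu' du]; suff -> : u^`() = u' by [].
by apply/funext => x; rewrite derive1E; exact: derive_val.
Qed.

Lemma bump_family_out (R : realType) (a b : R) (u : R -> R) (x : R) :
  bump_family a b u -> ~~ (a < x < b) -> u x = 0.
Proof.
move=> bu; rewrite negb_and -!leNgt => xab.
elim: bu => [p q|{}u v _ u0 _ v0]; last by rewrite /GRing.add/= u0 v0 addr0.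
by case/orP: xab => h; [rewrite flat_le0 ?mul0r|rewrite [X in _ * X]flat_le0 ?mulr0];
  rewrite ?subr_le0.
Qed.

Lemma bump_family_test (R : realType) (a b : R) (u : R -> R) :
  bump_family a b u -> test_function u.
Proof.
move=> bu; split; first by move=> k; exact: bump_family_class_C bu.
apply: (@subclosed_compact _ _ `[a, b]); [exact: closed_closure|exact: segment_compact|].
have <- : closure `[a, b] = `[a, b] :> set R.
  by apply/esym/closure_id; exact: interval_closed.
apply: closureS => x /= ux.
apply: contraT => nab; case/eqP: ux; apply: (bump_family_out bu).
by apply: contra nab; rewrite in_itv/= => /andP[/ltW-> /ltW->].
Qed.

(** * Pointwise bounds from weak derivatives *)

Lemma bump_family_continuous (R : realType) (a b : R) (psi : R -> R) :
  bump_family a b psi -> continuous psi.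
Proof. by move=> /(bump_family_class_C 0)[_ /(_ 0%N)]; exact. Qed.

Lemma bump_family_Rintegral (R : realType) (a b : R) (u psi : R -> R) :
  bump_family a b psi ->
  \int[@lebesgue_measure R]_x (u x * psi x) =
  \int[@lebesgue_measure R]_(x in `[a, b]) (u x * psi x).
Proof.
move=> bpsi; rewrite [RHS]Rintegral_mkcond; apply: eq_Rintegral => x _.
rewrite patchE; case: ifPn => // /negP xab; rewrite (bump_family_out bpsi) ?mulr0//.
apply/negP => /andP[ax xb]; apply: xab.
by rewrite inE/= in_itv/= !ltW.
Qed.

(** Both integrals reduce to [[a, b]], and the boundary terms vanish because [psi] is zero at [a]
    and [b]. *)
Lemma bump_family_by_parts (R : realType) (a b : R) (u u' psi : R -> R) :
  a < b -> (forall x : R, is_derive x 1 u (u' x)) -> continuous u' ->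
  bump_family a b psi ->
  \int[@lebesgue_measure R]_x (u x * psi^`()%classic x) =
  - \int[@lebesgue_measure R]_x (u' x * psi x).
Proof.
move=> ab du cu' bpsi.
have bpsi' := bump_family_derive1 bpsi.
rewrite (bump_family_Rintegral _ bpsi) (bump_family_Rintegral _ bpsi').
have dpsi x : derivable psi x 1.
  by have [d _] := bump_family_class_C 1 bpsi; exact: (d 0%N).
have LR (v : R -> R) : (forall x, derivable v x 1) -> derivable_oo_LRcontinuous v a b.
  move=> dv; have cv x : {for x, continuous v}.
    exact/differentiable_continuous/derivable1_diffP/dv.
  by split; [move=> x _; exact: dv|exact/cvg_at_right_filter/cv|
    exact/cvg_at_left_filter/cv].
rewrite (@Rintegration_by_parts R u psi u' psi^`()%classic a b ab).
- rewrite !(bump_family_out bpsi) ?ltxx ?andbF//.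
  by rewrite !mulr0 subrr sub0r.
- exact: continuous_subspaceT.
- by apply: LR => x; exact: ex_derive.
- by move=> x _; exact: is_derive_derive1.
- exact: (continuous_subspaceT (bump_family_continuous bpsi')).
- exact: LR.
- by [].
Qed.

Lemma class_C_is_derive (R : realType) (k j : nat) (u : R -> R) (x : R) :
  class_C k u -> (j < k)%N -> is_derive x 1 u^`(j) (u^`(j.+1)%classic x).
Proof.
move=> [du _] jk; rewrite derive1nS derive1E.
by apply: DeriveDef => //; exact: du.
Qed.

Lemma class_C_by_parts (R : realType) (a b : R) (u psi : R -> R) (j : nat) :
  a < b -> class_C j u -> bump_family a b psi ->
  \int[@lebesgue_measure R]_x (u x * psi^`(j)%classic x) =
  (-1) ^+ j * \int[@lebesgue_measure R]_x (u^`(j)%classic x * psi x).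
Proof.
move=> ab Cu; have : (j <= j)%N by [].
(* The induction runs over orders [i <= j] while [j] stays the regularity of [u]; [psi] is
   generalized because the hypothesis is applied to its derivative. *)
elim: {-2}j psi => [|i IH] psi ij bpsi; first by rewrite expr0 mul1r.
rewrite derive1Sn IH ?(ltnW ij)//; last exact: bump_family_derive1.
have du x := class_C_is_derive x Cu ij.
rewrite (bump_family_by_parts ab du _ bpsi); last by case: Cu => _ /(_ _ ij).
by rewrite exprS mulN1r mulNr mulrN.
Qed.

(** The norm of exponent [+oo] unfolds to an essential supremum only when the whole space has
    positive measure. *)
Lemma lebesgue_measureT_gt0 (R : realType) :
  (0 < @lebesgue_measure R [set: R])%E.
Proof.
have := @lebesgue_measure_itv R `]-oo, +oo[%R; rewrite set_itvNyy.
move=> ->; exact: lt0y.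
Qed.

Lemma Linfty_ae_bounded (R : realType) (w : R -> R) : in_Linfty w ->
  measurable_fun setT w /\
  exists2 M : R, 0 <= M & {ae @lebesgue_measure R, forall x, `|w x| <= M}.
Proof.
rewrite /in_Linfty inE => /andP[]; rewrite !inE /= => mw.
rewrite /finite_norm unlock /Lnorm ifT; last first.
  exact: lebesgue_measureT_gt0.
rewrite (_ : abse \o _ = EFin \o (fun x => `|w x|)); last exact/funext.
move=> /ess_supr_bounded[M wM]; split=> //.
exists `|M|; first exact: normr_ge0.
by apply: filterS wM => x /le_trans; apply; exact: ler_norm.
Qed.

Lemma bump_integral_gt0 (R : realType) (a b : R) (psi : R -> R) :
  a < b -> continuous psi -> (forall x, a < x < b -> 0 < psi x) ->
  (forall x, 0 <= psi x) ->
  0 < \int[@lebesgue_measure R]_(x in `[a, b]) psi x.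
Proof.
move=> ab cpsi psi_gt0 psi_ge0.
(* On the closed middle third [psi] has a positive minimum, which bounds the integral from below. *)
pose c := a + (b - a) / 3; pose d := a + (b - a) / 3 * 2.
have [ac cd db] : [/\ a < c, c < d & d < b] by rewrite /c /d; split; lra.
have [m mcd mmin] := EVT_min (ltW cd) (continuous_subspaceT cpsi).
have mgt0 : 0 < psi m.
  by apply: psi_gt0; move: mcd; rewrite in_itv/= => /andP[cm md]; apply/andP; split; lra.
have int_ab : lebesgue_measure.-integrable `[a, b] (EFin \o psi).
  by apply: continuous_compact_integrable; [exact: segment_compact|exact: continuous_subspaceT].
have fin_ab : (\int[@lebesgue_measure R]_(x in `[a, b]) (psi x)%:E)%E \is a fin_num.
  exact: integrable_fin_num int_ab.
rewrite /Rintegral fine_gt0// ltey_eq fin_ab andbT.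
apply: (@lt_le_trans _ _ (\int[lebesgue_measure]_(x in `[c, d]) (cst (psi m)%:E) x)%E).
  rewrite integral_cst//= lebesgue_measure_itv/= lte_fin cd.
  by rewrite -EFinB -EFinM lte_fin mulr_gt0// subr_gt0.
have /integrableP[mpsi _] := int_ab.
have sub : (`[c, d] : set R) `<=` `[a, b].
  by move=> y /=; rewrite !in_itv/= => /andP[cy yd]; apply/andP; split; lra.
apply: (@le_trans _ _ (\int[lebesgue_measure]_(x in `[c, d]) (psi x)%:E)%E).
  apply: ge0_le_integral => //.
  - by move=> x _; rewrite lee_fin ltW.
  - exact: measurable_funS mpsi.
by apply: ge0_subset_integral => // x _; rewrite lee_fin.
Qed.

Lemma Rintegral_ae_bounded (R : realType) (a b M : R) (w psi : R -> R) :
  measurable_fun setT w -> 0 <= M ->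
  {ae @lebesgue_measure R, forall x, `|w x| <= M} ->
  continuous psi -> (forall x, 0 <= psi x) ->
  `|\int[@lebesgue_measure R]_(x in `[a, b]) (w x * psi x)| <=
  M * \int[@lebesgue_measure R]_(x in `[a, b]) psi x.
Proof.
move=> mw M0 wM cpsi psi0.
have int_psi : lebesgue_measure.-integrable `[a, b] (EFin \o psi).
  by apply: continuous_compact_integrable; [exact: segment_compact|exact: continuous_subspaceT].
have mpsi : measurable_fun `[a, b] psi by apply: measurable_funTS; exact: continuous_measurable_fun.
have int_Mpsi : lebesgue_measure.-integrable `[a, b] (EFin \o (fun x => M * psi x)).
  by apply: (integrableZl _ M int_psi).
have mwpsi : measurable_fun `[a, b] (fun x => w x * psi x).
  by apply: measurable_funM => //; exact: measurable_funTS.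
(* This bound serves twice: it yields the integrability of [w * psi], and then the estimate
   itself. *)
have le_int : (\int[@lebesgue_measure R]_(x in `[a, b]) `|(w x * psi x)%:E| <=
    \int[@lebesgue_measure R]_(x in `[a, b]) (M * psi x)%:E)%E.
  apply: ae_ge0_le_integral => //.
  - by apply/measurable_EFinP; exact: measurableT_comp.
  - by move=> x _; rewrite lee_fin mulr_ge0.
  - by apply/measurable_EFinP; exact: measurable_funM.
  - apply: (@filterS _ _ (ae_filter_ringOfSetsType _) _ _ _ wM) => x wMx _.
    by rewrite lee_fin normrM (ger0_norm (psi0 x)) ler_wpM2r.
have finM : (\int[@lebesgue_measure R]_(x in `[a, b]) (M * psi x)%:E)%E \is a fin_num.
  exact: integrable_fin_num int_Mpsi.
have int_wpsi : lebesgue_measure.-integrable `[a, b] (EFin \o (fun x => w x * psi x)).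
  apply/integrableP; split; first exact/measurable_EFinP.
  by apply: le_lt_trans le_int _; rewrite ltey_eq finM.
rewrite -RintegralZl// -lee_fin EFin_normr_Rintegral//.
rewrite [leRHS]fineK//.
apply: le_trans le_int; apply: le_abse_integral => //.
exact/measurable_EFinP.
Qed.

(* If |u^(j)| exceeded the bound M of its weak version at some point, it would do
   so on an interval ]a, b[, and testing against a bump on ]a, b[ gives a
   contradiction. *)
Lemma weak_derivative_bounded (R : realType) (j : nat) (u w : R -> R) :
  class_C j u -> in_Linfty w -> is_weak_derivative j u w ->
  exists M : R, forall x, `|u^`(j)%classic x| <= M.
Proof.
move=> Cu /Linfty_ae_bounded[mw [M M0 wM]] uw; exists M.
(* The sign [s] treats the upper and the lower bound at once. *)
suff H (s : R) : `|s| = 1 -> forall x, s * u^`(j)%classic x <= M.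
  by move=> x; rewrite ler_norml lerNl -mulN1r H ?normrN1// -[leLHS]mul1r H// normr1.
move=> s1 x; rewrite leNgt; apply/negP => Mx.
have cu : continuous u^`(j)%classic by case: Cu => _ /(_ j); exact.
pose e := (s * u^`(j)%classic x - M) / 2.
have e0 : 0 < e by rewrite /e; lra.
have : \forall y \near x, M + e < s * u^`(j)%classic y.
  have c : {for x, continuous (fun y => s * u^`(j)%classic y)}.
    by apply: continuousM; [exact: cst_continuous|exact: cu].
  by apply: (cvgr_gt _ c); rewrite /e; lra.
move=> /nbhs_ballP[d /= d0 xd].
pose a := x - d / 2; pose b := x + d / 2.
have ab : a < b by rewrite /a /b; lra.
have big y : a <= y <= b -> M + e < s * u^`(j)%classic y.
  move=> /andP[ay yb]; apply: xd; rewrite /ball/= ltr_norml.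
  by move: ay yb; rewrite /a /b => *; apply/andP; split; lra.
pose phi y : R := flat 1 (y - a) * flat 1 (b - y).
have bphi : bump_family a b phi by exact: bump_prod.
have cphi := bump_family_continuous bphi.
have flat1 (z : R) : 0 < z -> 0 < flat 1 z.
  by move=> z0; rewrite /flat z0 hornerC mul1r expR_gt0.
have flat1_ge0 (z : R) : 0 <= flat 1 z.
  by have [/flat1/ltW//|z0] := ltP 0 z; rewrite flat_le0.
have phi0 y : 0 <= phi y by rewrite mulr_ge0.
have I0 : 0 < \int[@lebesgue_measure R]_(y in `[a, b]) phi y.
  apply: bump_integral_gt0 => // y /andP[ay yb].
  by rewrite mulr_gt0// flat1// subr_gt0.
have := uw phi (bump_family_test bphi).
rewrite (class_C_by_parts ab Cu bphi) !(bump_family_Rintegral _ bphi).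
move=> /(@lreg_sign _ j) E.
have := Rintegral_ae_bounded a b mw M0 wM cphi phi0.
(* It remains to show that [M] times the integral of [phi] is strictly less than the absolute value
   of the integral of [u^(j) phi]; the margin is [e]. *)
rewrite leNgt => /negP; apply; rewrite -E.
have int_c (v : R -> R) : continuous v ->
    lebesgue_measure.-integrable `[a, b] (EFin \o v).
  by move=> cv; apply: continuous_compact_integrable;
    [exact: segment_compact|exact: continuous_subspaceT].
have cup : continuous (fun y => u^`(j)%classic y * phi y).
  by move=> y; apply: cvgM; [exact: cu|exact: cphi].
apply: (@lt_le_trans _ _ ((M + e) * \int[@lebesgue_measure R]_(y in `[a, b]) phi y)).
  by rewrite ltr_pM2r// ltrDl.
apply: (@le_trans _ _ (s * \int[@lebesgue_measure R]_(y in `[a, b]) (u^`(j)%classic y * phi y))).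
  rewrite -!RintegralZl//; try exact: int_c.
  apply: le_Rintegral => //.
  - by apply: int_c => y; apply: cvgM; [exact: cvg_cst|exact: cphi].
  - by apply: int_c => y; apply: cvgM; [exact: cvg_cst|exact: cup].
  - move=> y /=; rewrite in_itv/= => /big /ltW h.
    by rewrite mulrA ler_wpM2r.
by apply: le_trans (ler_norm _) _; rewrite normrM s1 mul1r.
Qed.

Lemma continuous_Linfty_bounded (R : realType) (u : R -> R) :
  continuous u -> in_Linfty u -> exists M : R, forall x, `|u x| <= M.
Proof.
(* A function is its own weak derivative of order 0. *)
move=> cu uL; apply: (@weak_derivative_bounded R 0 u u) => //.
  by split=> // -[].
by move=> phi _; rewrite expr0 mul1r.
Qed.

Lemma bounded_continuous_Linfty (R : realType) (u : R -> R) (M : R) :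
  continuous u -> (forall x, `|u x| <= M) -> in_Linfty u.
Proof.
move=> cu uM; rewrite /in_Linfty inE; apply/andP; split; rewrite !inE/=.
  exact: continuous_measurable_fun.
rewrite /finite_norm unlock /Lnorm ifT; last first.
  exact: lebesgue_measureT_gt0.
apply: (@le_lt_trans _ _ M%:E); last exact: ltry.
by apply/ess_supP; apply: nearW => x /=; rewrite lee_fin.
Qed.

(** * Inverse of the characteristic map *)

(** The order of [x] and [z] is left free, which spares case distinctions in the estimates below. *)
Lemma MVT_eq (R : realType) (f df : R -> R) (x z : R) :
  (forall y : R, is_derive y 1 f (df y)) ->
  exists y, Num.min x z <= y <= Num.max x z /\ f x - f z = df y * (x - z).
Proof.
move=> fdf.
have cf : continuous f by move=> y; exact: is_derive_continuous (fdf y).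
wlog zx : x z / z <= x.
  move=> H; have /orP[xz|/H//] := le_total x z.
  have [y [yxz E]] := H z x xz; exists y; rewrite minC maxC; split=> //.
  by rewrite -opprB E -mulrN opprB.
have [y yzx E] := MVT_segment zx (fun y _ => fdf y) (continuous_subspaceT cf).
by exists y; split=> //; rewrite min_r// max_l//; move: yzx; rewrite in_itv.
Qed.

Lemma bounded_derive_lipschitz (R : realType) (f df : R -> R) (K x z : R) :
  (forall y : R, is_derive y 1 f (df y)) -> (forall y, `|df y| <= K) ->
  `|f x - f z| <= K * `|x - z|.
Proof.
by move=> /(MVT_eq x z)[y [_ ->]] dfK; rewrite normrM ler_wpM2r.
Qed.

(* [Xi(a, y)], with junk value 0 when [x + a * u x = y] has no solution [x]. *)
Definition char_inv (R : realType) (u : R -> R) (a y : R) : R :=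
  xget 0 [set x | x + a * u x = y].

(** The slope of the characteristic map [x + a * u x] is at least [c]; later one [c] serves for all
    relevant [a]. *)
Definition nondegenerate (R : realType) (u : R -> R) (c a : R) : Prop :=
  forall x, c <= 1 + a * u^`()%classic x.

Section char_inv.
Context {R : realType} (u : R -> R) (U c : R).
Hypothesis u_derivable : forall x : R, is_derive x 1 u (u^`()%classic x).
Hypothesis u_bounded : forall x, `|u x| <= U.
Hypothesis c_gt0 : 0 < c.
Local Notation Xi := (char_inv u).

Lemma char_expand (a x z : R) : nondegenerate u c a ->
  c * `|x - z| <= `|(x + a * u x) - (z + a * u z)|.
Proof.
move=> ac.
have df (y : R) : is_derive y 1 (fun y => y + a * u y) (1 + a * u^`()%classic y).
  apply: (is_derive_eq (is_derive_funD (is_derive_fun_id y)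
    (is_derive_funM (is_derive_fun_cst a y) (u_derivable y)))).
  by rewrite mul0r add0r.
have [y [_ ->]] := MVT_eq x z df.
by rewrite normrM ler_wpM2r// (le_trans (ac y))// ler_norm.
Qed.

(** The map moves points by at most [|a| U], so its values at [y - |a| U] and [y + |a| U] enclose
    [y], and the intermediate value theorem applies. *)
Lemma char_surj (a y : R) : exists x, x + a * u x = y.
Proof.
have U0 : 0 <= U by exact: le_trans (u_bounded 0).
have au z : `|a * u z| <= `|a| * U by rewrite normrM ler_wpM2l.
have aU0 : 0 <= `|a| * U by rewrite mulr_ge0.
have cf : continuous (fun z => z + a * u z).
  move=> z; apply: cvgD; first exact: cvg_id.
  by apply: cvgM; [exact: cvg_cst|exact: is_derive_continuous (u_derivable z)].
have [||x _ xy] := @IVT R (fun z => z + a * u z) (y - `|a| * U) (y + `|a| * U) y _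
  (continuous_subspaceT cf).
- by lra.
- have := au (y - `|a| * U); have := au (y + `|a| * U).
  rewrite !ler_norml => /andP[h1 h2] /andP[h3 h4].
  by rewrite ge_min le_max; apply/andP; split; apply/orP; [left|right]; lra.
- by exists x.
Qed.

Lemma char_invK (a y : R) : Xi a y + a * u (Xi a y) = y.
Proof. by rewrite /char_inv; case: xgetP => [//|/= H]; have [x /H] := char_surj a y. Qed.

(** Apply the expansion at parameter [a]; replacing [a] by [b] in the image of the second point
    costs at most [|a - b| U]. Nondegeneracy is asked of one parameter, which becomes the limit in
    [char_inv_cvg]. *)
Lemma char_inv_lipschitz (a b y z : R) : nondegenerate u c a ->
  c * `|Xi a y - Xi b z| <= `|y - z| + `|a - b| * U.
Proof.
move=> ac; apply: le_trans (char_expand _ _ ac) _.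
have := char_invK a y; have := char_invK b z.
move: (Xi a y) (Xi b z) => x x' <- <-.
have -> : x + a * u x - (x' + a * u x') =
  (x + a * u x - (x' + b * u x')) - (a - b) * u x' by ring.
apply: le_trans (ler_normB _ _) _; rewrite lerD2l normrM.
by rewrite ler_wpM2l.
Qed.

Lemma char_inv_unique (a x : R) : nondegenerate u c a -> Xi a (x + a * u x) = x.
Proof.
move=> ac; apply/eqP; rewrite -subr_eq0 -normr_le0 -(pmulr_rle0 _ c_gt0).
by apply: le_trans (char_expand _ _ ac) _; rewrite char_invK subrr normr0.
Qed.

(** The filter is arbitrary so that the statement covers limits in one variable as well as joint
    limits in [(t, x)]. *)
Lemma char_inv_cvg (T : Type) (F : set_system T) {FF : Filter F} (a y : T -> R)
    (a0 y0 : R) : nondegenerate u c a0 ->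
  a @ F --> a0 -> y @ F --> y0 -> (fun t => Xi (a t) (y t)) @ F --> Xi a0 y0.
Proof.
move=> ac aF yF.
have H : (fun t => c^-1 * (`|y0 - y t| + `|a0 - a t| * U)) @ F --> (0 : R).
  have -> : (0 : R) = c^-1 * (`|y0 - y0| + `|a0 - a0| * U).
    by rewrite !subrr normr0 mul0r addr0 mulr0.
  apply: cvgM; first exact: cvg_cst.
  apply: cvgD; first exact: cvg_norm (cvgB (cvg_cst _) yF).
  apply: cvgM; last exact: cvg_cst.
  exact: cvg_norm (cvgB (cvg_cst _) aF).
apply/cvgrPdist_le => e e0.
have /cvgrPdist_le/(_ e e0) := H; apply: filterS => t.
rewrite sub0r normrN ger0_norm; last first.
  rewrite mulr_ge0 ?invr_ge0 ?(ltW c_gt0)// addr_ge0// mulr_ge0//.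
  exact: le_trans (u_bounded 0).
apply: le_trans; rewrite ler_pdivlMl//.
exact: char_inv_lipschitz.
Qed.

(** Implicit differentiation along a curve, so that time and space derivatives are both instances.
    Subtracting the equations of [Xi] at [s] and [t] gives [(Xi_s - xi) (1 + a(s) gu(Xi_s)) = (s -
    t) (gy(s) - ga(s) u(xi))], where [gu], [ga], [gy] are the continuous slopes of Caratheodory. *)
Lemma is_derive_char_inv (a y : R -> R) (t da dy : R) :
  (\forall s \near t, nondegenerate u c (a s)) ->
  is_derive t 1 a da -> is_derive t 1 y dy ->
  is_derive t 1 (fun s => Xi (a s) (y s))
    ((dy - da * u (Xi (a t) (y t))) / (1 + a t * u^`()%classic (Xi (a t) (y t)))).
Proof.
move=> near_c ha hy; have act := nbhs_singleton near_c.
set xi := Xi (a t) (y t); set J := 1 + _.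
have J0 : J != 0 by rewrite gt_eqF// (lt_le_trans c_gt0)//; exact: act.
have /is_derive1_caratheodory[gu [guE guc gux]] := u_derivable xi.
have ca := is_derive_continuous ha; have cy := is_derive_continuous hy.
move/is_derive1_caratheodory : ha => [ga [gaE gac gat]].
move/is_derive1_caratheodory : hy => [gy [gyE gyc gyt]].
have cxi : (fun s => Xi (a s) (y s)) @ t --> xi by exact: char_inv_cvg.
pose den s := 1 + a s * gu (Xi (a s) (y s)).
have cden : den @ t --> J.
  rewrite /J -gux; apply: cvgD; first exact: cvg_cst.
  by apply: cvgM => //; exact: (cvg_comp _ _ cxi guc).
pose G s := (gy s - ga s * u xi) / den s.
have cG : G @ t --> (dy - da * u xi) / J.
  rewrite -gyt -gat; apply: cvgM; last exact: cvgV.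
  exact: cvgB gyc (cvgM gac (cvg_cst _)).
pose D s := if s == t then (dy - da * u xi) / J else (Xi (a s) (y s) - xi) / (s - t).
have Dt : D t = (dy - da * u xi) / J by rewrite /D eqxx.
apply/is_derive1_caratheodory; exists D; split => //.
- move=> s; rewrite /D; have [->|st] := eqVneq; first by rewrite !subrr mulr0.
  by rewrite divfK// subr_eq0.
- change (D @ t --> D t); rewrite Dt; apply: cvg_trans cG; apply: near_eq_cvg.
  have den0 : \forall s \near t, den s != 0.
    by apply: (cvgr_neq0 _ cden).
  near=> s; rewrite /D; have [->|st] := eqVneq.
    by rewrite /G /den -/xi gux gyt gat.
  have d0 : den s != 0 by near: s.
  have st0 : s - t != 0 by rewrite subr_eq0.
  apply: (mulIf st0); rewrite divfK//; apply: (mulIf d0).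
  rewrite mulrAC divfK// mulrBl -gyE mulrAC -gaE /den mulrDr mulr1 mulrCA [_ * gu _]mulrC -guE.
  have := char_invK (a s) (y s); have := char_invK (a t) (y t); rewrite -/xi => {1}<- {1}<-.
  by ring.
Unshelve. all: by end_near. Qed.

End char_inv.

(** * Calculus on the half-plane *)

(** Times slightly larger than [t] always belong to the filter, even at [t = 0]; hence the limit
    defining [dt] is unique. *)
Lemma dnbhs_nonneg_proper (R : realType) (t : R) : 0 <= t ->
  ProperFilter (within [set s : R | 0 <= s] t^').
Proof.
move=> t0; apply: Build_ProperFilter_ex => P.
rewrite /dnbhs /within/= => /nbhs_ballP[d /= d0 H].
exists (t + d / 2); apply: H; rewrite /ball/=; last by lra.
- by rewrite opprD addrA subrr sub0r normrN gtr0_norm; lra.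
- by rewrite gt_eqF//; lra.
Qed.

Lemma is_derive_dt (R : realType) (u : R -> R -> R) (t x l : R) : 0 <= t ->
  is_derive t 1 (u ^~ x) l -> dt_quotient u t x --> l /\ dt u t x = l.
Proof.
move=> t0 /is_derive1_caratheodory[g [gE gc <-]].
have ql : dt_quotient u t x --> g t.
  move=> A /gc gA.
  change (\forall s \near t, s != t -> 0 <= s -> A ((u s x - u t x) / (s - t))).
  have {}gA : \forall s \near t, A (g s) by exact: gA.
  by apply: filterS gA => s As st _; rewrite gE mulfK// subr_eq0.
split=> //; have := dnbhs_nonneg_proper t0 => ?.
exact: (@cvg_lim).
Qed.

(** For [t > 0] all times near [t] are nonnegative, so the restricted limit is an ordinary two-sided
    one. *)
Lemma dt_is_derive (R : realType) (u : R -> R -> R) (t x : R) : 0 < t ->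
  cvg (dt_quotient u t x) -> is_derive t 1 (u ^~ x) (dt u t x).
Proof.
move=> t0 cu; rewrite /dt; set l := lim _; have {cu} : dt_quotient u t x --> l by exact: cu.
move=> ql; apply/is_derive1_caratheodory.
pose D s := if s == t then l else (u s x - u t x) / (s - t).
have Dt : D t = l by rewrite /D eqxx.
exists D; split => //.
  move=> s; rewrite /D; have [->|st] := eqVneq; first by rewrite !subrr mulr0.
  by rewrite divfK// subr_eq0.
apply/continuous_withinNx; rewrite Dt.
move=> A /ql H; change (\forall s \near t, s != t -> A (D s)).
have {}H : \forall s \near t, s != t -> 0 <= s -> A ((u s x - u t x) / (s - t)).
  exact: H.
have tpos : \forall s \near t, 0 < s by exact: lt_nbhsr.
by apply: filterS2 H tpos => s H s0 st; rewrite /D ifN_eq//; apply: H => //; exact: ltW.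
Qed.

(** Meant for [u = dt w] or [u = dx w], which is known by a formula [v] at nonnegative times
    only. *)
Lemma continuous_halfplane_eq (R : realType) (u v : R -> R -> R) :
  (forall t x, 0 <= t -> u t x = v t x) ->
  (forall t x, 0 <= t -> {for (t, x), continuous (fun p : R * R => v p.1 p.2)}) ->
  continuous_halfplane u.
Proof.
move=> uv cv; apply/subspace_continuousP => -[t x] /= t0 A.
change (nbhs (u t x) A -> \forall p \near (t, x), 0 <= p.1 -> A (u p.1 p.2)).
rewrite uv// => /(cv t x t0) vA.
have {}vA : \forall p \near (t, x), A (v p.1 p.2) by exact: vA.
by apply: filterS vA => p Ap p0; rewrite uv.
Qed.

Lemma class_C1_halfplane_intro (R : realType) (u ut ux : R -> R -> R) :
  (forall t x : R, 0 <= t -> is_derive t 1 (u ^~ x) (ut t x)) ->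
  (forall t x : R, 0 <= t -> is_derive x 1 (u t) (ux t x)) ->
  (forall t x, 0 <= t -> {for (t, x), continuous (fun p : R * R => u p.1 p.2)}) ->
  (forall t x, 0 <= t -> {for (t, x), continuous (fun p : R * R => ut p.1 p.2)}) ->
  (forall t x, 0 <= t -> {for (t, x), continuous (fun p : R * R => ux p.1 p.2)}) ->
  class_C1_halfplane u.
Proof.
move=> dut dux cu cut cux; split.
- exact: continuous_halfplane_eq cu.
- move=> t x t0; split; last by have [] := dux t x t0.
  by have [ql _] := is_derive_dt t0 (dut t x t0); apply/cvg_ex; exists (ut t x).
- apply: continuous_halfplane_eq cut => t x t0.
  by have [] := is_derive_dt t0 (dut t x t0).
- apply: continuous_halfplane_eq cux => t x t0.
  exact: is_derive_derive1 (dux t x t0).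
Qed.

Lemma continuous_halfplane_curve (R : realType) (u : R -> R -> R) (X : R -> R) (T : R) :
  continuous_halfplane u -> continuous X ->
  {within `[0, T], continuous (fun t => u t (X t))}.
Proof.
move=> /subspace_continuousP cu cX; apply/subspace_continuousP => t /=.
rewrite in_itv/= => /andP[t0 tT] A.
change (nbhs (u t (X t)) A -> \forall s \near t, s \in `[0, T]%R -> A (u s (X s))).
move=> /(cu (t, X t) t0) uA.
have {}uA : \forall p \near (t, X t), 0 <= p.1 -> A (u p.1 p.2) by exact: uA.
have cp : (fun s => (s, X s)) @ t --> (t, X t).
  by apply: (@cvg_pair R R R (nbhs t) (nbhs t) (nbhs (X t)) _ _ _ id X);
    [exact: cvg_id|exact: cX].
have {}uA : \forall s \near t, 0 <= s -> A (u s (X s)) by exact: (cp _ uA).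
by apply: filterS uA => s As; rewrite in_itv/= => /andP[s0 _]; exact: As.
Qed.

(* Only partial derivatives are available: split the increment at [u t (X s)] and
   apply the mean value theorem to the first half. *)
Lemma is_derive_curve (R : realType) (u : R -> R -> R) (X : R -> R) (t dX : R) :
  class_C1_halfplane u -> 0 < t -> continuous X -> is_derive t 1 X dX ->
  is_derive t 1 (fun s => u s (X s)) (dt u t (X t) + dx u t (X t) * dX).
Proof.
move=> [_ du cut _] t0 cX dXt.
have dut (s x : R) : 0 < s -> is_derive s 1 (u ^~ x) (dt u s x).
  by move=> s0; apply: dt_is_derive => //; case: (du s x (ltW s0)).
have dux : is_derive (X t) 1 (u t) (dx u t (X t)).
  by rewrite /dx derive1E; apply: derivableP; case: (du t (X t) (ltW t0)).
have dA : is_derive t 1 (fun s => u s (X s) - u t (X s)) (dt u t (X t)).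
  apply/is_derive1_caratheodory.
  set l := dt u t (X t).
  pose D s := if s == t then l else (u s (X s) - u t (X s)) / (s - t).
  have Dt : D t = l by rewrite /D eqxx.
  exists D; split => //.
    move=> s; rewrite /D subrr subr0; have [->|st] := eqVneq; first by rewrite !subrr mulr0.
    by rewrite divfK// subr_eq0.
  change (D @ t --> D t); rewrite Dt; apply/cvgrPdist_lt => e e0.
  have := (subspace_continuousP _ _).1 cut (t, X t) (ltW t0).
  move=> /cvgrPdist_lt/(_ e e0); rewrite /within/= => /nbhs_ballP[d /= d0 H].
  have XH : \forall s \near t, `|X t - X s| < d by move/cvgrPdist_lt: (cX t); exact.
  (* Staying closer to [t] than [t] itself keeps all intermediate times positive, where [dt] is a
     two-sided derivative. *)
  have sH : \forall s \near t, `|t - s| < Num.min d t.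
    have m0 : 0 < Num.min d t by rewrite lt_min d0.
    by move/cvgrPdist_lt: (@cvg_id _ (nbhs t)); apply.
  near=> s; rewrite /D; have [_|st] := eqVneq; first by rewrite subrr normr0.
  have Xs : `|X t - X s| < d by near: s.
  have : `|t - s| < Num.min d t by near: s.
  rewrite lt_min => /andP[sd st'].
  have pos y : Num.min s t <= y <= Num.max s t -> 0 < y /\ `|t - y| < d.
    move: sd st'; rewrite !ltr_norml => /andP[? ?] /andP[? ?].
    by case: (leP s t) => ? /andP[? ?]; split; try apply/andP; try split; lra.
  have [y ymm ->] : exists2 y, Num.min s t <= y <= Num.max s t &
      u s (X s) - u t (X s) = dt u y (X s) * (s - t).
    have mM : Num.min s t <= Num.max s t by rewrite ge_min !le_max !lexx.
    have dy (y : R) : y \in `]Num.min s t, Num.max s t[%R ->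
        is_derive y 1 (u ^~ (X s)) (dt u y (X s)).
      rewrite in_itv/= => /andP[h1 h2]; apply: dut.
      by have [] := pos y; rewrite // !ltW.
    have cy : {within `[Num.min s t, Num.max s t], continuous (u ^~ (X s))}.
      apply: derivable_within_continuous => y; rewrite in_itv/= => /pos[y0 _].
      by have [] := dut y (X s) y0.
    have [y] := MVT_segment mM dy cy.
    rewrite in_itv/= => ymm E; exists y => //; move: E.
    case: (leP s t) => _ // E.
    by rewrite -opprB E -mulrN opprB.
  rewrite mulfK ?subr_eq0//; have [y0 yd] := pos y ymm.
  by apply: (H (y, X s)); [split|exact: ltW].
have dB := is_derive_fun_comp dux dXt.
have := is_derive_funD dA dB; apply: near_eq_is_derive.
by near=> s; rewrite subrK.
Unshelve. all: by end_near. Qed.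

Lemma linear_ode_zero (R : realType) (T K : R) (w k : R -> R) : 0 <= T ->
  {within `[0, T], continuous w} ->
  (forall t : R, 0 < t < T -> is_derive t 1 w (k t * w t)) ->
  (forall t, 0 < t < T -> `|k t| <= K) -> w 0 = 0 -> w T = 0.
Proof.
move=> T0 cw dw kK w0.
(* [w^2 exp(-2Kt)] is nonincreasing. *)
pose E t := w t * w t * expR (- (2 * K) * t).
have dlin (t : R) : is_derive t 1 (fun t => - (2 * K) * t) (- (2 * K)).
  apply: (is_derive_eq (is_derive_funM (is_derive_fun_cst _ _) (is_derive_fun_id t))).
  by rewrite mul0r add0r mulr1.
have dE (t : R) : t \in `]0, T[%R -> is_derive t 1 E
    (2 * (k t - K) * (w t * w t) * expR (- (2 * K) * t)).
  rewrite in_itv/= => /dw dwt.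
  apply: (is_derive_eq (is_derive_funM (is_derive_funM dwt dwt)
    (is_derive_fun_comp (is_derive_expR _) (dlin t)))).
  by ring.
have : E T <= E 0.
  have dE' t : t \in `]0, T[%R -> derivable E t 1 by move=> /dE ?; exact: ex_derive.
  apply: (@ler0_derive1_le_cc R E 0 T dE') => //.
  - move=> t tT; rewrite (is_derive_derive1 (dE t tT)).
    have kt : k t <= K.
      by apply: le_trans (ler_norm _) _; apply: kK; move: tT; rewrite in_itv.
    rewrite mulr_le0_ge0 ?expR_ge0// mulr_le0_ge0 -?expr2 ?sqr_ge0//.
    by rewrite mulr_ge0_le0// subr_le0.
  - apply/subspace_continuousP => t tT.
    have cwt := (subspace_continuousP _ _).1 cw t tT.
    apply: cvgM; first exact: cvgM.
    apply: cvg_within_filter.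
    exact: (is_derive_continuous (is_derive_fun_comp (is_derive_expR _) (dlin t))).
  - by rewrite in_itv/= lexx T0.
  - by rewrite in_itv/= lexx T0.
rewrite /E w0 !mul0r pmulr_lle0 ?expR_gt0// -expr2 => h.
by apply/eqP; rewrite -sqrf_eq0 eq_le h sqr_ge0.
Qed.

(** * The transported density *)

(** Conservation of mass: the initial density at the foot of the characteristic, divided by the
    Jacobian of the characteristic map. *)
Definition density (R : realType) (u r0 : R -> R) (a y : R) : R :=
  r0 (char_inv u a y) / (1 + a * u^`()%classic (char_inv u a y)).

(** The rate of change of [Xi(a, y)] when [a] and [y] move with velocities [da] and [dy];
    [density_rate] is the analogue for [density]. *)
Definition char_inv_rate (R : realType) (u : R -> R) (a y da dy : R) : R :=
  (dy - da * u (char_inv u a y)) / (1 + a * u^`()%classic (char_inv u a y)).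

Definition density_rate (R : realType) (u r0 : R -> R) (a y da dy : R) : R :=
  let x := char_inv u a y in
  let J := 1 + a * u^`()%classic x in
  let dx := char_inv_rate u a y da dy in
  r0^`()%classic x * dx / J -
  r0 x * (da * u^`()%classic x + a * (u^`(2)%classic x * dx)) / J ^+ 2.

Section density.
Context {R : realType} (u r0 : R -> R) (U c : R).
Hypothesis u_C2 : class_C 2 u.
Hypothesis r0_C1 : class_C 1 r0.
Hypothesis u_bounded : forall x, `|u x| <= U.
Hypothesis c_gt0 : 0 < c.
Local Notation Xi := (char_inv u).

Let du (x : R) : is_derive x 1 u (u^`()%classic x).
Proof. exact: (class_C_is_derive x u_C2 (isT : (0 < 2)%N)). Qed.

Let du' (x : R) : is_derive x 1 u^`()%classic (u^`(2)%classic x).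
Proof. exact: (class_C_is_derive x u_C2 (isT : (1 < 2)%N)). Qed.

Let dr0 (x : R) : is_derive x 1 r0 (r0^`()%classic x).
Proof. exact: (class_C_is_derive x r0_C1 (isT : (0 < 1)%N)). Qed.

Lemma is_derive_density (a y : R -> R) (t da dy : R) :
  (\forall s \near t, nondegenerate u c (a s)) ->
  is_derive t 1 a da -> is_derive t 1 y dy ->
  is_derive t 1 (fun s => density u r0 (a s) (y s))
    (density_rate u r0 (a t) (y t) da dy).
Proof.
move=> near_c ha hy; have act := nbhs_singleton near_c.
have hx := is_derive_char_inv du u_bounded c_gt0 near_c ha hy.
have J0 : 1 + a t * u^`()%classic (Xi (a t) (y t)) != 0.
  by rewrite gt_eqF// (lt_le_trans c_gt0)//; exact: act.
have hJ := is_derive_funD (is_derive_fun_cst 1 t)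
  (is_derive_funM ha (is_derive_fun_comp (du' _) hx)).
apply: (is_derive_eq (is_derive_funM (is_derive_fun_comp (dr0 _) hx)
  (is_derive_funV hJ J0))).
rewrite /density_rate -/(char_inv_rate u (a t) (y t) da dy).
by rewrite add0r mulNr mulrN !mulrA.
Qed.

Section cvg.
Context (T : Type) (F : set_system T) {FF : Filter F}.
Variables (a y : T -> R) (a0 y0 : R).
Hypotheses (a0_nondeg : nondegenerate u c a0) (cvg_a : a @ F --> a0) (cvg_y : y @ F --> y0).

Lemma cvg_comp_char_inv (f : R -> R) : continuous f ->
  (fun t => f (Xi (a t) (y t))) @ F --> f (Xi a0 y0).
Proof.
move=> cf.
apply: (cvg_comp _ _ (char_inv_cvg du u_bounded c_gt0 a0_nondeg cvg_a cvg_y)).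
exact: cf.
Qed.

Lemma cvg_jacobian_inv :
  (fun t => (1 + a t * u^`()%classic (Xi (a t) (y t)))^-1) @ F -->
  (1 + a0 * u^`()%classic (Xi a0 y0))^-1.
Proof.
apply: cvgV; first by rewrite gt_eqF// (lt_le_trans c_gt0).
apply: cvgD; first exact: cvg_cst.
apply: cvgM => //; apply: cvg_comp_char_inv => x.
exact: is_derive_continuous (du' x).
Qed.

Lemma density_cvg : (fun t => density u r0 (a t) (y t)) @ F --> density u r0 a0 y0.
Proof.
apply: cvgM; last exact: cvg_jacobian_inv.
by apply: cvg_comp_char_inv => x; exact: is_derive_continuous (dr0 x).
Qed.

Context (da dy : T -> R) (da0 dy0 : R).
Hypotheses (cvg_da : da @ F --> da0) (cvg_dy : dy @ F --> dy0).

Lemma char_inv_rate_cvg :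
  (fun t => char_inv_rate u (a t) (y t) (da t) (dy t)) @ F -->
  char_inv_rate u a0 y0 da0 dy0.
Proof.
apply: cvgM; last exact: cvg_jacobian_inv.
apply: cvgB => //; apply: cvgM => //; apply: cvg_comp_char_inv => x.
exact: is_derive_continuous (du x).
Qed.

Lemma density_rate_cvg :
  (fun t => density_rate u r0 (a t) (y t) (da t) (dy t)) @ F -->
  density_rate u r0 a0 y0 da0 dy0.
Proof.
have cu' : continuous u^`()%classic by move=> x; exact: is_derive_continuous (du' x).
have cu'' : continuous u^`(2)%classic by case: u_C2 => _; apply.
have cr : continuous r0 by move=> x; exact: is_derive_continuous (dr0 x).
have cr' : continuous r0^`()%classic by case: r0_C1 => _ /(_ 1%N); apply.
have cdx := char_inv_rate_cvg; have cJ := cvg_jacobian_inv.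
rewrite /density_rate; apply: cvgB.
  by apply: cvgM => //; apply: cvgM => //; exact: cvg_comp_char_inv.
(* The inverse square becomes a product of two inverse Jacobians, whose limit is known. *)
under eq_fun do rewrite -exprVn expr2; rewrite -exprVn expr2.
apply: cvgM; last exact: cvgM.
apply: cvgM; first exact: cvg_comp_char_inv.
apply: cvgD; apply: cvgM => //; first exact: cvg_comp_char_inv.
by apply: cvgM => //; exact: cvg_comp_char_inv.
Qed.

End cvg.

Section bounds.
Context (K L P P' : R).
Hypothesis u'_bounded : forall x, `|u^`()%classic x| <= K.
Hypothesis u''_bounded : forall x, `|u^`(2)%classic x| <= L.
Hypothesis r0_bounded : forall x, `|r0 x| <= P.
Hypothesis r0'_bounded : forall x, `|r0^`()%classic x| <= P'.

Lemma density_lipschitz (a b y : R) : nondegenerate u c a -> nondegenerate u c b ->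
  `|density u r0 a y - density u r0 b y| <=
  (P * (K + `|b| * (L * (c^-1 * U))) / c ^+ 2 + P' * (c^-1 * U) / c) * `|a - b|.
Proof.
move=> ac bc; rewrite /density.
have xle : `|Xi a y - Xi b y| <= c^-1 * U * `|a - b|.
  rewrite -mulrA ler_pdivlMl//.
  have := char_inv_lipschitz du u_bounded b y y ac.
  by rewrite subrr normr0 add0r [_ * U]mulrC.
move: (Xi a y) (Xi b y) (ac (Xi a y)) (bc (Xi b y)) xle => x z.
set d1 := 1 + a * _; set d2 := 1 + b * _ => d1c d2c xle.
have d10 : 0 < d1 by exact: lt_le_trans d1c.
have d20 : 0 < d2 by exact: lt_le_trans d2c.
(* Separates the variation of the Jacobian from that of the initial density; the denominators are at
   least [c^2] and [c]. *)
have -> : r0 x / d1 - r0 z / d2 = r0 x * (d2 - d1) / (d1 * d2) + (r0 x - r0 z) / d2.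
  by field; rewrite !gt_eqF.
have L0 : 0 <= L := le_trans (normr_ge0 _) (u''_bounded 0).
have P'0 : 0 <= P' := le_trans (normr_ge0 _) (r0'_bounded 0).
have P0 : 0 <= P := le_trans (normr_ge0 _) (r0_bounded 0).
have dle : `|d2 - d1| <= (K + `|b| * (L * (c^-1 * U))) * `|a - b|.
  (* The Jacobian changes through the parameter, controlled by [K], and through the foot point,
     controlled by [L]. *)
  have -> : d2 - d1 = - ((a - b) * u^`()%classic x) - b * (u^`()%classic x - u^`()%classic z).
    by rewrite /d1 /d2; ring.
  apply: le_trans (ler_normB _ _) _; rewrite normrN !normrM mulrDl; apply: lerD.
    by rewrite mulrC ler_wpM2r.
  rewrite -mulrA ler_wpM2l// -mulrA.
  apply: le_trans (bounded_derive_lipschitz x z du' u''_bounded) _.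
  by rewrite ler_wpM2l.
have rle : `|r0 x - r0 z| <= P' * (c^-1 * U) * `|a - b|.
  apply: le_trans (bounded_derive_lipschitz x z dr0 r0'_bounded) _.
  by rewrite -mulrA ler_wpM2l.
apply: le_trans (ler_normD _ _) _; rewrite [leRHS]mulrDl; apply: lerD; rewrite [leRHS]mulrAC normrM.
  apply: ler_pM => //.
    by rewrite normrM -[leRHS]mulrA; exact: ler_pM.
  rewrite normfV gtr0_norm ?mulr_gt0// lef_pV2 ?posrE ?mulr_gt0 ?exprn_gt0//.
  by rewrite expr2; apply: ler_pM => //; exact: ltW.
by apply: ler_pM => //; rewrite normfV gtr0_norm// lef_pV2.
Qed.

End bounds.
End density.

(** * Uniqueness and the explicit solution *)

Lemma norm_le_between (R : realDomainType) (x a b : R) :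
  a <= x -> x <= b -> `|x| <= `|a| + `|b|.
Proof.
move=> ax xb; have [x0|x0] := leP 0 x.
  by rewrite ger0_norm// (le_trans xb)// (le_trans (ler_norm _))// lerDr.
rewrite ltr0_norm//.
apply: (@le_trans _ _ (- a)); first by rewrite lerN2.
by rewrite -normrN (le_trans (ler_norm _))// lerDl.
Qed.

(* Along [X xi], the difference [w = v - V xi] satisfies [w' = - (omega + v_x) w], so
   [v] is determined without solving the characteristic ODE of [v]; then
   the difference of the densities satisfies [r' = - v_x r]. *)
Lemma C1_halfplane_solution_unique (R : realType) (omega vstar : R) (rho0 v0 : R -> R)
    (rho1 v1 rho2 v2 : R -> R -> R) :
  (forall t x, 0 <= t -> exists xi,
    x = xi + vstar * t + (1 - expR (- omega * t)) / omega * (v0 xi - vstar)) ->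
  omega != 0 ->
  is_solution omega vstar rho0 v0 rho1 v1 -> is_solution omega vstar rho0 v0 rho2 v2 ->
  forall t x, 0 <= t -> rho1 t x = rho2 t x /\ v1 t x = v2 t x.
Proof.
move=> X_surj omega0.
pose V xi (t : R) := vstar + expR (- omega * t) * (v0 xi - vstar).
pose X xi (t : R) := xi + vstar * t + (1 - expR (- omega * t)) / omega * (v0 xi - vstar).
have dlin (t : R) : is_derive t 1 (fun t => - omega * t) (- omega).
  apply: (is_derive_eq (is_derive_funM (is_derive_fun_cst _ _) (is_derive_fun_id t))).
  by rewrite mul0r add0r mulr1.
have dexp (t : R) := is_derive_fun_comp (is_derive_expR _) (dlin t).
have dV xi (t : R) : is_derive t 1 (V xi) (- omega * (V xi t - vstar)).
  apply: (is_derive_eq (is_derive_funD (is_derive_fun_cst vstar t)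
    (is_derive_funM (dexp t) (is_derive_fun_cst (v0 xi - vstar) t)))).
  by rewrite /V; ring.
have dX xi (t : R) : is_derive t 1 (X xi) (V xi t).
  apply: (is_derive_eq (is_derive_funD (is_derive_funD (is_derive_fun_cst xi t)
    (is_derive_funM (is_derive_fun_cst vstar t) (is_derive_fun_id t)))
    (is_derive_funM (is_derive_funM (is_derive_funB (is_derive_fun_cst 1 t) (dexp t))
      (is_derive_fun_cst omega^-1 t)) (is_derive_fun_cst (v0 xi - vstar) t)))).
  by rewrite /V; field.
have cX xi : continuous (X xi) by move=> t; exact: is_derive_continuous (dX xi t).
have X0 xi : X xi 0 = xi by rewrite /X !mulr0 expR0 subrr !mul0r !addr0.
(* Compactness of [[0, T]] bounds the coefficient of the linear equations along the curve. *)
have dx_bounded (w : R -> R -> R) xi (T : R) : 0 <= T -> class_C1_halfplane w ->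
    exists K, forall t, 0 <= t <= T -> `|dx w t (X xi t)| <= K.
  move=> T0 [_ _ _ cdx].
  have cd := continuous_halfplane_curve (T := T) cdx (cX xi).
  have [M _ HM] := EVT_max T0 cd; have [m _ Hm] := EVT_min T0 cd.
  exists (`|dx w m (X xi m)| + `|dx w M (X xi M)|) => t tT.
  have HMt : dx w t (X xi t) <= dx w M (X xi M) by apply: HM; rewrite in_itv.
  have Hmt : dx w m (X xi m) <= dx w t (X xi t) by apply: Hm; rewrite in_itv.
  exact: norm_le_between Hmt HMt.
have vX rho v : is_solution omega vstar rho0 v0 rho v ->
    forall xi t, 0 <= t -> v t (X xi t) = V xi t.
  move=> [_ Cv _ eqv init] xi T T0; apply/eqP; rewrite -subr_eq0; apply/eqP.
  have [K HK] := dx_bounded v xi T T0 Cv.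
  apply: (@linear_ode_zero R T (`|omega| + K) (fun t => v t (X xi t) - V xi t)
    (fun t => - (omega + dx v t (X xi t)))) => //.
  - have [cv _ _ _] := Cv.
    apply/subspace_continuousP => t tT; apply: cvgB.
      exact: (subspace_continuousP _ _).1 (continuous_halfplane_curve (T := T) cv (cX xi)) t tT.
    by apply: cvg_within_filter; exact: is_derive_continuous (dV xi t).
  - move=> t /andP[t0 _].
    apply: (is_derive_eq (is_derive_funB (is_derive_curve Cv t0 (cX xi) (dX xi t)) (dV xi t))).
    have := eqv t (X xi t) (ltW t0) => /(canRL (addrK _)) ->.
    by ring.
  - move=> t /andP[t0 tT]; rewrite normrN (le_trans (ler_normD _ _))// lerD2l HK//.
    by rewrite !ltW.
  - by rewrite X0 (init xi).2 /V mulr0 expR0; ring.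
move=> sol1 sol2.
have veq t x : 0 <= t -> v1 t x = v2 t x.
  by move=> t0; have [xi ->] := X_surj t x t0; rewrite (vX _ _ sol1)// (vX _ _ sol2).
move=> t x t0; split; last exact: veq.
have [xi ->] := X_surj t x t0; apply/eqP; rewrite -subr_eq0; apply/eqP.
have Cv1 : class_C1_halfplane v1 by case: sol1.
have [K HK] := dx_bounded v1 xi t t0 Cv1.
(* As [v = V xi] on the curve, [X xi] is a characteristic of every solution, and the continuity
   equation becomes an ordinary differential equation along it. *)
have drho rho v : is_solution omega vstar rho0 v0 rho v -> forall s : R, 0 < s ->
    is_derive s 1 (fun s => rho s (X xi s)) (- rho s (X xi s) * dx v s (X xi s)).
  move=> sol s s0; have [Crho _ eqrho _ _] := sol.
  apply: (is_derive_eq (is_derive_curve Crho s0 (cX xi) (dX xi s))).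
  rewrite -(vX _ _ sol xi s (ltW s0)).
  by have /eqP := eqrho s (X xi s) (ltW s0); rewrite addr_eq0 mulNr => /eqP <-; ring.
apply: (@linear_ode_zero R t K (fun s => rho1 s (X xi s) - rho2 s (X xi s))
  (fun s => - dx v1 s (X xi s))) => //.
- have [[c1 _ _ _] _ _ _ _] := sol1; have [[c2 _ _ _] _ _ _ _] := sol2.
  apply/subspace_continuousP => s st.
  by apply: cvgB; apply: (subspace_continuousP _ _).1 s st;
    exact: continuous_halfplane_curve.
- move=> s /andP[s0 _].
  apply: (is_derive_eq (is_derive_funB (drho _ _ sol1 s s0) (drho _ _ sol2 s s0))).
  (* The velocities agree on the whole line at time [s], hence so do their space derivatives, and
     both densities obey the same linear equation. *)
  have -> : dx v2 s (X xi s) = dx v1 s (X xi s).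
    rewrite /dx; congr (derive1 _ _); apply/funext => y.
    by rewrite veq// ltW.
  by ring.
- by move=> s /andP[s0 st]; rewrite normrN HK// !ltW.
- have [_ _ _ _ i1] := sol1; have [_ _ _ _ i2] := sol2.
  by rewrite X0 (i1 xi).1 (i2 xi).1 subrr.
Qed.

Section explicit_solution.
Context {R : realType} (omega vstar : R) (v0 r0 : R -> R) (U c delta : R).
Local Notation u := (fun x => v0 x - vstar).
Hypothesis omega_gt0 : 0 < omega.
Hypothesis u_C2 : class_C 2 u.
Hypothesis r0_C1 : class_C 1 r0.
Hypothesis u_bounded : forall x, `|u x| <= U.
Hypothesis c_gt0 : 0 < c.
Hypothesis delta_gt0 : 0 < delta.
(* Values [a < 0] make the formulas valid for small negative times, so that
   two-sided derivatives exist at [t = 0]. *)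
Hypothesis nondeg : forall a, - delta <= a <= omega^-1 -> nondegenerate u c a.

Definition char_time (t : R) : R := (1 - expR (- omega * t)) / omega.

Definition explicit_density (t x : R) : R := density u r0 (char_time t) (x - vstar * t).

Definition explicit_velocity (t x : R) : R :=
  vstar + expR (- omega * t) * u (char_inv u (char_time t) (x - vstar * t)).

Let du (x : R) : is_derive x 1 u (derive1 u x).
Proof. exact: (class_C_is_derive x u_C2 (isT : (0 < 2)%N)). Qed.

Let du' (x : R) : is_derive x 1 (derive1 u) (derive1n 2 u x).
Proof. exact: (class_C_is_derive x u_C2 (isT : (1 < 2)%N)). Qed.

Let decay (t : R) : is_derive t 1 (fun t => expR (- omega * t)) (- omega * expR (- omega * t)).
Proof.
apply: (is_derive_eq (is_derive_fun_comp (is_derive_expR _)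
  (is_derive_funM (is_derive_fun_cst _ _) (is_derive_fun_id t)))).
by rewrite mul0r add0r mulr1 mulrC.
Qed.

Lemma char_time_bounds (t : R) : 0 <= t -> 0 <= char_time t < omega^-1.
Proof.
move=> t0; rewrite /char_time ltr_pdivrMr// mulVf ?gt_eqF// gtrBl expR_gt0 andbT.
apply: divr_ge0; last exact: ltW.
by rewrite subr_ge0 expR_le1 mulNr oppr_le0 mulr_ge0// ltW.
Qed.

Lemma is_derive_char_time (t : R) : is_derive t 1 char_time (expR (- omega * t)).
Proof.
apply: (is_derive_eq (is_derive_funM (is_derive_funB (is_derive_fun_cst 1 t) (decay t))
  (is_derive_fun_cst omega^-1 t))).
by field; rewrite gt_eqF.
Qed.

(** The bound [char_time s <= 1/omega] holds for every real [s]; continuity keeps [char_time s]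
    above [- delta] near [t]. *)
Lemma near_nondegenerate (t : R) : 0 <= t ->
  \forall s \near t, nondegenerate u c (char_time s).
Proof.
move=> t0; have /andP[a0 _] := char_time_bounds t0.
have ca := is_derive_continuous (is_derive_char_time t).
have h : - delta < char_time t by apply: lt_le_trans a0; rewrite oppr_lt0.
have near_gt : \forall s \near t, - delta < char_time s by exact: (cvgr_gt _ ca).
apply: filterS near_gt => s hs; apply: nondeg.
rewrite (ltW hs)/= /char_time ler_pdivrMr// mulVf ?gt_eqF// gerBl.
Qed.

Let nondeg_time (t : R) : 0 <= t -> nondegenerate u c (char_time t).
Proof. by move=> t0; exact: nbhs_singleton (near_nondegenerate t0). Qed.

Let shift_t (t x : R) : is_derive t 1 (fun s => x - vstar * s) (- vstar).
Proof.
apply: (is_derive_eq (is_derive_funB (is_derive_fun_cst x t)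
  (is_derive_funM (is_derive_fun_cst vstar t) (is_derive_fun_id t)))).
by rewrite mul0r mulr1 !add0r.
Qed.

Let shift_x (t x : R) : is_derive x 1 (fun y => y - vstar * t) 1.
Proof.
by apply: (is_derive_eq (is_derive_funB (is_derive_fun_id x)
  (is_derive_fun_cst (vstar * t) x))); rewrite subr0.
Qed.

(** In time, [char_time t] moves at rate [exp(-omega t)] and [x - vstar t] at rate [- vstar]; in
    space the rates are [0] and [1]. *)
Let explicit_density_t t x := density_rate u r0 (char_time t) (x - vstar * t)
  (expR (- omega * t)) (- vstar).

Let explicit_density_x t x := density_rate u r0 (char_time t) (x - vstar * t) 0 1.

Let explicit_velocity_t t x :=
  let xi := char_inv u (char_time t) (x - vstar * t) in
  - omega * expR (- omega * t) * u xi + expR (- omega * t) * (derive1 u xi *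
    char_inv_rate u (char_time t) (x - vstar * t) (expR (- omega * t)) (- vstar)).

Let explicit_velocity_x t x :=
  let xi := char_inv u (char_time t) (x - vstar * t) in
  expR (- omega * t) * (derive1 u xi *
    char_inv_rate u (char_time t) (x - vstar * t) 0 1).

Let density_dt (t x : R) : 0 <= t ->
  is_derive t 1 (explicit_density ^~ x) (explicit_density_t t x).
Proof.
move=> t0; exact: (is_derive_density u_C2 r0_C1 u_bounded c_gt0 (near_nondegenerate t0)
  (is_derive_char_time t) (shift_t t x)).
Qed.

Let near_cst (t x : R) : 0 <= t -> \forall s \near x, nondegenerate u c (char_time t).
Proof. by move=> t0; apply: (@nearW _ (nbhs x)) => _; exact: nondeg_time. Qed.

Let density_dx (t x : R) : 0 <= t ->
  is_derive x 1 (explicit_density t) (explicit_density_x t x).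
Proof.
move=> t0; exact: (is_derive_density u_C2 r0_C1 u_bounded c_gt0 (near_cst x t0)
  (is_derive_fun_cst (char_time t) x) (shift_x t x)).
Qed.

Let velocity_dt (t x : R) : 0 <= t ->
  is_derive t 1 (explicit_velocity ^~ x) (explicit_velocity_t t x).
Proof.
move=> t0; have dxi := is_derive_char_inv du u_bounded c_gt0 (near_nondegenerate t0)
  (is_derive_char_time t) (shift_t t x).
apply: (is_derive_eq (is_derive_funD (is_derive_fun_cst vstar t)
  (is_derive_funM (decay t) (is_derive_fun_comp (du _) dxi)))).
by rewrite add0r.
Qed.

Let velocity_dx (t x : R) : 0 <= t ->
  is_derive x 1 (explicit_velocity t) (explicit_velocity_x t x).
Proof.
move=> t0; have dxi := is_derive_char_inv du u_bounded c_gt0 (near_cst x t0)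
  (is_derive_fun_cst (char_time t) x) (shift_x t x).
apply: (is_derive_eq (is_derive_funD (is_derive_fun_cst vstar x)
  (is_derive_funM (is_derive_fun_cst (expR (- omega * t)) x)
    (is_derive_fun_comp (du _) dxi)))).
by rewrite add0r [X in X + _]mul0r add0r.
Qed.

Let cvg_time (t x : R) : (fun p : R * R => char_time p.1) @ (t, x) --> char_time t.
Proof.
apply: (cvg_comp _ _ (@cvg_fst _ _ (nbhs t) (nbhs x) _)).
exact: is_derive_continuous (is_derive_char_time t).
Qed.

Let cvg_decay (t x : R) :
  (fun p : R * R => expR (- omega * p.1)) @ (t, x) --> expR (- omega * t).
Proof.
apply: (cvg_comp _ (fun s => expR (- omega * s)) (@cvg_fst _ _ (nbhs t) (nbhs x) _)).
exact: is_derive_continuous (decay t).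
Qed.

Let cvg_shift (t x : R) : (fun p : R * R => p.2 - vstar * p.1) @ (t, x) --> x - vstar * t.
Proof.
apply: cvgB; first exact: cvg_snd.
by apply: cvgM; [exact: cvg_cst|exact: cvg_fst].
Qed.

Lemma explicit_density_C1 : class_C1_halfplane explicit_density.
Proof.
apply: (class_C1_halfplane_intro density_dt density_dx) => t x t0.
- exact: (density_cvg u_C2 r0_C1 u_bounded c_gt0 (nondeg_time t0)
    (@cvg_time t x) (@cvg_shift t x)).
- exact: (density_rate_cvg u_C2 r0_C1 u_bounded c_gt0 (nondeg_time t0)
    (@cvg_time t x) (@cvg_shift t x) (@cvg_decay t x) (cvg_cst _)).
- exact: (density_rate_cvg u_C2 r0_C1 u_bounded c_gt0 (nondeg_time t0)
    (@cvg_time t x) (@cvg_shift t x) (cvg_cst _) (cvg_cst _)).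
Qed.

Lemma explicit_velocity_C1 : class_C1_halfplane explicit_velocity.
Proof.
have cu : continuous u by move=> x; exact: is_derive_continuous (du x).
have cu' : continuous (derive1 u) by move=> x; exact: is_derive_continuous (du' x).
have cxi (f : R -> R) (t x : R) : continuous f -> 0 <= t ->
    (fun p : R * R => f (char_inv u (char_time p.1) (p.2 - vstar * p.1))) @ (t, x) -->
    f (char_inv u (char_time t) (x - vstar * t)).
  move=> cf t0; exact: (cvg_comp_char_inv u_C2 u_bounded c_gt0 (nondeg_time t0)
    (@cvg_time t x) (@cvg_shift t x) cf).
apply: (class_C1_halfplane_intro velocity_dt velocity_dx) => t x t0.
- apply: cvgD; first exact: cvg_cst.
  by apply: cvgM; [exact: cvg_decay|exact: (cxi u)].
- apply: cvgD.
    apply: cvgM; last exact: (cxi u).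
    by apply: cvgM; [exact: cvg_cst|exact: cvg_decay].
  apply: cvgM; first exact: cvg_decay.
  apply: cvgM; first exact: (cxi (derive1 u)).
  exact: (char_inv_rate_cvg u_C2 u_bounded c_gt0 (nondeg_time t0)
    (@cvg_time t x) (@cvg_shift t x) (@cvg_decay t x) (cvg_cst _)).
- apply: cvgM; first exact: cvg_decay.
  apply: cvgM; first exact: (cxi (derive1 u)).
  exact: (char_inv_rate_cvg u_C2 u_bounded c_gt0 (nondeg_time t0)
    (@cvg_time t x) (@cvg_shift t x) (cvg_cst _) (cvg_cst _)).
Qed.

Lemma explicit_solution : is_solution omega vstar r0 v0 explicit_density explicit_velocity.
Proof.
have jac t x : 0 <= t -> 1 + char_time t * derive1 u x != 0.
  by move=> t0; rewrite gt_eqF// (lt_le_trans c_gt0)//; exact: nondeg_time.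
split; [exact: explicit_density_C1|exact: explicit_velocity_C1| | |].
(* With the rates inserted, both equations are rational identities whose only delicate denominator
   is the Jacobian. *)
- move=> t x t0.
  have [_ ->] := is_derive_dt t0 (density_dt x t0).
  rewrite /dx (is_derive_derive1 (density_dx x t0)) (is_derive_derive1 (velocity_dx x t0)).
  rewrite /explicit_density_t /explicit_density_x /explicit_velocity_x /explicit_velocity
    /explicit_density /density /density_rate /char_inv_rate /=.
  by have := jac t (char_inv u (char_time t) (x - vstar * t)) t0 => J0; field.
- move=> t x t0.
  have [_ ->] := is_derive_dt t0 (velocity_dt x t0).
  rewrite /dx (is_derive_derive1 (velocity_dx x t0)).
  rewrite /explicit_velocity_t /explicit_velocity_x /explicit_velocity /char_inv_rate /=.
  by have := jac t (char_inv u (char_time t) (x - vstar * t)) t0 => J0; field.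
- move=> x.
  (* At time 0 the characteristic map is the identity. *)
  have a0 : char_time 0 = 0 by rewrite /char_time mulr0 expR0 subrr mul0r.
  have xi0 : char_inv u 0 x = x.
    have := char_inv_unique du u_bounded c_gt0 x (nondeg_time (lexx 0)).
    by rewrite a0 mul0r addr0.
  rewrite /explicit_density /explicit_velocity /density a0 mulr0 subr0 xi0 mulr0 expR0.
  by rewrite mul0r addr0 divr1 mul1r [vstar + _]addrC subrK.
Qed.

End explicit_solution.

(** * Constants drawn from the hypotheses, and assembly of the result *)

Lemma class_C_leq (R : realType) (j k : nat) (u : R -> R) :
  (j <= k)%N -> class_C k u -> class_C j u.
Proof.
move=> jk [du cu]; split=> i ij; first by apply: du; exact: leq_trans ij jk.
by apply: cu; exact: leq_trans ij jk.
Qed.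

Lemma class_C_subr_cst (R : realType) (k : nat) (u : R -> R) (b : R) : class_C k u ->
  class_C k (fun x => u x - b) /\
  forall j, (0 < j <= k)%N -> (fun x => u x - b)^`(j)%classic = u^`(j)%classic.
Proof.
move=> Cu; have du (x : R) : (0 < k)%N -> is_derive x 1 (fun x => u x - b) (derive1 u x).
  move=> k0; apply: (is_derive_eq (is_derive_funB (class_C_is_derive x Cu k0)
    (is_derive_fun_cst b x))).
  by rewrite subr0.
have E j : (0 < j <= k)%N -> (fun x => u x - b)^`(j)%classic = u^`(j)%classic.
  case: j => [//|j jk]; have k0 : (0 < k)%N by exact: leq_ltn_trans jk.
  rewrite [LHS]derive1Sn [RHS]derive1Sn; congr derive1n; apply/funext => x.
  exact: is_derive_derive1 (du x k0).
split=> //; case: (Cu) => dC cC; split=> -[|j] jk x.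
- by have [] := du x jk.
- by rewrite E ?(ltnW jk)//; exact: dC.
- apply: cvgB; last exact: cvg_cst.
  exact: (cC 0%N).
- by rewrite E//; exact: cC.
Qed.

Lemma Winfty_class_C_bounded (R : realType) (k j : nat) (u : R -> R) :
  class_C k u -> in_Winfty k u -> (j <= k)%N ->
  exists M : R, forall x, `|u^`(j)%classic x| <= M.
Proof.
move=> Cu [uL uW] jk; case: j jk => [|j] jk.
  by apply: continuous_Linfty_bounded uL; case: Cu => _ /(_ 0%N); exact.
have [w wL uw] := uW j.+1 jk.
exact: (weak_derivative_bounded (class_C_leq jk Cu) wL uw).
Qed.

(** For [a >= 0] the worst slope is at [a = 1/omega], where it is at least
    [1 + min(m, 0)/omega > 0]. For [a < 0] the choice of [delta] gives [|a u'| <= 1/2]; [K + 1]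
    replaces [K] to avoid dividing by zero. *)
Lemma nondegenerate_interval (R : realType) (u : R -> R) (omega m K : R) :
  0 < omega -> - omega < m -> (forall x, m <= u^`()%classic x) ->
  (forall x, `|u^`()%classic x| <= K) ->
  exists c delta, [/\ 0 < c, 0 < delta &
    forall a, - delta <= a <= omega^-1 -> nondegenerate u c a].
Proof.
move=> om0 mom mu uK; have K0 : 0 <= K := le_trans (normr_ge0 _) (uK 0).
pose m' := Num.min m 0.
exists (Num.min 2^-1 (1 + m' / omega)), (2 * (K + 1))^-1; split.
- rewrite lt_min invr_gt0 ltr0n/= -[1](@mulfV _ omega) ?gt_eqF// -mulrDl divr_gt0//.
  by rewrite /m'; case: (ltP m 0) => ?; lra.
- by rewrite invr_gt0 mulr_gt0// ltr_wpDl.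
move=> a /andP[da ao] x; rewrite ge_min; apply/orP.
have [a0|a0] := leP 0 a; [right|left].
  rewrite lerD2l; apply: (@le_trans _ _ (a * m')).
    by rewrite mulrC ler_wnM2r// /m' ge_min lexx orbT.
  by rewrite ler_wpM2l// (le_trans _ (mu x))// /m' ge_min lexx.
have : `|a * u^`()%classic x| <= 2^-1.
  rewrite normrM (ltr0_norm a0).
  apply: (@le_trans _ _ ((2 * (K + 1))^-1 * (K + 1))); last first.
    by rewrite invfM mulfVK// gt_eqF// ltr_wpDl.
  apply: ler_pM => //; first by rewrite oppr_ge0 ltW.
    by rewrite lerNl.
  by rewrite (le_trans (uK x))// lerDl.
by rewrite ler_norml => /andP[h _]; lra.
Qed.

Theorem theorem3p2 (R : realType) (mu vmax vstar omega : R)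
    (f rho0 v0 : R -> R)
    (mu_gt0 : 0 < mu) (vstar_gt0 : 0 < vstar) (vstar_lt_vmax : vstar < vmax)
    (f_C1 : class_C 1 f) (f_ndecr : {homo f : x y / x <= y})
    (f_ge : forall x, Num.max x 0 <= f x)
    (omegaE : omega = mu + g vmax vstar f 0)
    (rho0_C1 : class_C 1 rho0) (rho0_W1 : in_Winfty 1 rho0)
    (v0_C2 : class_C 2 v0) (v0_W2 : in_Winfty 2 v0)
    (v0_inf : ((- omega)%:E < ereal_inf (range (fun x => (derive1 v0 x)%:E)))%E)
    (rho0_gt0 : forall x, 0 < rho0 x) :
  exists rho v : R -> R -> R,
    is_solution omega vstar rho0 v0 rho v /\
    (forall rho' v' : R -> R -> R, is_solution omega vstar rho0 v0 rho' v' ->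
       forall t x, 0 <= t -> rho' t x = rho t x /\ v' t x = v t x) /\
    (forall t, 0 <= t ->
       (ereal_sup (range (fun x => (rho t x)%:E)) <=
        (omega * sup (range rho0) /
           (omega + (1 - expR (- omega * t)) * inf (range (derive1 v0))))%:E)%E) /\
    (forall t, 0 <= t ->
       (ereal_sup (range (fun x => `|v t x - vstar|%:E)) <=
        (expR (- omega * t) *
           sup (range (fun x => (`|v0 x - vstar| : R))))%:E)%E) /\
    (forall t x, 0 <= t -> 0 < rho t x) /\
    exists h : R -> R,
      (forall x, 0 < h x) /\ class_C 1 h /\ in_Linfty h /\
      (ereal_sup [set (`|rho p.1 p.2 - h (p.2 - vstar * p.1)| *
                       expR (omega * p.1))%:E | p in [set p : R * R | (0 <= p.1)%R]]
         < +oo)%E.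
Proof.
(* [m] is the infimum itself: [-oo] contradicts the strict bound, and [+oo] contradicts the value at
   [0]. *)
have [m m_gt m_le] : exists2 m, - omega < m & forall x, m <= derive1 v0 x.
  have lb x : (ereal_inf (range (fun x => (derive1 v0 x)%:E)) <= (derive1 v0 x)%:E)%E.
    by apply: ereal_inf_lbound; exists x.
  move: v0_inf lb; case: (ereal_inf _) => [r| |//].
    by rewrite lte_fin => omr lb; exists r => // x; rewrite -lee_fin.
  by move=> _ /(_ 0).
(* [g(0)] is a nonnegative multiple of [f(0)], and [f(0) >= 0]. *)
have omega_gt0 : 0 < omega.
  rewrite omegaE /g mul0r subr0 ltr_wpDr// divr_ge0 ?mulr_ge0 ?subr_ge0//; try lra.
  by apply: le_trans (f_ge 0); rewrite maxxx.
pose u x := v0 x - vstar.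
have [u_C2 uE] := class_C_subr_cst vstar v0_C2.
have u1E x : u^`()%classic x = derive1 v0 x by exact: (congr1 (@^~ x) (uE 1%N isT)).
have [P rho0_le] := Winfty_class_C_bounded rho0_C1 rho0_W1 (leq0n _).
have [P' rho0'_le] := Winfty_class_C_bounded rho0_C1 rho0_W1 (leqnn 1).
have [V v0_le] := Winfty_class_C_bounded v0_C2 v0_W2 (leq0n _).
have [K v0'_le] := Winfty_class_C_bounded v0_C2 v0_W2 (isT : (1 <= 2)%N).
have [L v0''_le] := Winfty_class_C_bounded v0_C2 v0_W2 (leqnn 2).
have u_bd x : `|u x| <= V + `|vstar|.
  by rewrite (le_trans (ler_normB _ _))// lerD2r; exact: v0_le.
have du (x : R) : is_derive x 1 u (u^`()%classic x).
  exact: (class_C_is_derive x u_C2 (isT : (0 < 2)%N)).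
have u'_ge x : m <= u^`()%classic x by rewrite u1E.
have u'_le x : `|u^`()%classic x| <= K by rewrite u1E; exact: v0'_le.
have u''_le x : `|u^`(2)%classic x| <= L by rewrite (uE 2%N isT).
have [c [delta [c_gt0 delta_gt0 nondeg]]] :=
  nondegenerate_interval omega_gt0 m_gt u'_ge u'_le.
pose rho := explicit_density omega vstar v0 rho0.
pose v := explicit_velocity omega vstar v0.
have sol : is_solution omega vstar rho0 v0 rho v.
  exact: (explicit_solution omega_gt0 u_C2 rho0_C1 u_bd c_gt0 delta_gt0 nondeg).
have nondeg_t t : 0 <= t -> nondegenerate u c (char_time omega t).
  move=> t0; have /andP[a0 a1] := char_time_bounds omega_gt0 t0.
  by apply: nondeg; rewrite (ltW a1) andbT; lra.
have nondeg_oo : nondegenerate u c omega^-1.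
  by apply: nondeg; rewrite lexx andbT; have := invr_gt0 omega; rewrite omega_gt0; lra.
have jac_gt0 a x : nondegenerate u c a -> 0 < 1 + a * u^`()%classic x.
  by move=> /(_ x); exact: lt_le_trans.
have dens_gt0 a y : nondegenerate u c a -> 0 < density u rho0 a y.
  by move=> ac; rewrite divr_gt0// jac_gt0.
exists rho, v; split=> //; split; [|split; [|split; [|split]]].
- move=> rho' v' sol'.
  apply: C1_halfplane_solution_unique sol' sol; last by rewrite gt_eqF.
  (* The characteristic through [(t, x)] starts at the inverse image of [x - vstar t]. *)
  move=> t x t0; exists (char_inv u (char_time omega t) (x - vstar * t)).
  rewrite -/(char_time omega t).
  have := char_invK du u_bd (char_time omega t) (x - vstar * t).
  by rewrite /u => E; rewrite addrAC E subrK.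
- move=> t t0; apply: ge_ereal_sup => _ [x _ <-]; rewrite lee_fin.
  have /andP[a0 a1] := char_time_bounds omega_gt0 t0.
  rewrite /rho /explicit_density /density; set xi := char_inv _ _ _.
  set S := sup _; set I := inf _.
  (* Real [sup] and [inf] are meaningful for bounded sets; [P] and [m] supply the bounds. *)
  have rS : rho0 xi <= S.
    apply: ub_le_sup; last by exists xi.
    by exists P => _ [y _ <-]; rewrite (le_trans (ler_norm _))//; exact: rho0_le.
  have Ile : I <= derive1 v0 xi.
    by apply: ge_inf; [exists m => _ [y _ <-]|exists xi].
  have mI : m <= I by apply: lb_le_inf; [exists (derive1 v0 0); exists 0|move=> _ [y _ <-]].
  (* Since [I > -omega] and [0 <= char_time < 1/omega], this is at least
     [1 - omega char_time > 0]. *)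
  have J0 : 0 < 1 + char_time omega t * I.
    have : char_time omega t * omega < 1 by rewrite -ltr_pdivlMr// mul1r.
    have : char_time omega t * - omega <= char_time omega t * I.
      by rewrite ler_wpM2l// ltW// (lt_le_trans m_gt).
    by rewrite mulrN; lra.
  (* The claimed bound is thus [S / (1 + a(t) I)], compared with the density in numerator and
     denominator separately. *)
  have -> : omega + (1 - expR (- omega * t)) * I = omega * (1 + char_time omega t * I).
    by rewrite /char_time; field; rewrite gt_eqF.
  rewrite -mulf_div divff ?gt_eqF// mul1r.
  apply: ler_pM; rewrite ?invr_ge0 ?(ltW (rho0_gt0 _)) ?(ltW (jac_gt0 _ _ (nondeg_t _ t0)))//.
  rewrite lef_pV2 ?posrE//; last exact/jac_gt0/nondeg_t.
  by rewrite lerD2l ler_wpM2l// u1E.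
- move=> t t0; apply: ge_ereal_sup => _ [x _ <-]; rewrite lee_fin.
  rewrite /v /explicit_velocity addrC addKr normrM gtr0_norm ?expR_gt0//.
  rewrite ler_wpM2l ?expR_ge0//; apply: ub_le_sup.
    by exists (V + `|vstar|) => _ [y _ <-]; exact: u_bd.
  by exists (char_inv u (char_time omega t) (x - vstar * t)).
- by move=> t x t0; exact/dens_gt0/nondeg_t.
(* The profile is the density at the limit [1/omega] of [char_time]. *)
exists (density u rho0 omega^-1).
have dh (y : R) : is_derive y 1 (density u rho0 omega^-1)
    (density_rate u rho0 omega^-1 y 0 1).
  have near_oo : \forall s \near y, nondegenerate u c omega^-1.
    by apply: (@nearW _ (nbhs y)) => _; exact: nondeg_oo.
  exact: (is_derive_density u_C2 rho0_C1 u_bd c_gt0 near_oo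
    (is_derive_fun_cst omega^-1 y) (is_derive_fun_id y)).
have ch : continuous (density u rho0 omega^-1).
  by move=> y; exact: is_derive_continuous (dh y).
split; [|split; [|split]].
- by move=> y; exact: dens_gt0.
- split=> [[|//] _ y|[|[|//]] _]; first by have [] := dh y.
    exact: ch.
  have -> : derive1n 1 (density u rho0 omega^-1) =
      (fun y => density_rate u rho0 omega^-1 y 0 1).
    by apply/funext => y; exact: is_derive_derive1 (dh y).
  move=> y; exact: (density_rate_cvg u_C2 rho0_C1 u_bd c_gt0 nondeg_oo
    (cvg_cst _) cvg_id (cvg_cst _) (cvg_cst _)).
- apply: (@bounded_continuous_Linfty _ _ (P / c)) => // y.
  rewrite normrM; apply: ler_pM => //.
  by rewrite normfV gtr0_norm ?jac_gt0// lef_pV2 ?posrE ?jac_gt0//; exact: nondeg_oo.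
(* [C] is the constant of [density_lipschitz] for [b = 1/omega]. The gap [1/omega - a(t)] equals
   [exp(-omega t) / omega], so the weight [exp(omega t)] cancels it and leaves [C / omega]. *)
pose C := P * (K + `|omega^-1| * (L * (c^-1 * (V + `|vstar|)))) / c ^+ 2 +
  P' * (c^-1 * (V + `|vstar|)) / c.
apply: (@le_lt_trans _ _ (C / omega)%:E); last exact: ltry.
apply: ge_ereal_sup => _ [[t x] /= t0 <-]; rewrite lee_fin.
have := density_lipschitz u_C2 rho0_C1 u_bd c_gt0 u'_le u''_le rho0_le rho0'_le
  (x - vstar * t) (nondeg_t t t0) nondeg_oo.
rewrite -/C; have -> : char_time omega t - omega^-1 = - (expR (- omega * t) / omega).
  by rewrite /char_time; field; rewrite gt_eqF.
have gap_gt0 : 0 < expR (- omega * t) / omega by rewrite divr_gt0 ?expR_gt0.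
rewrite normrN (gtr0_norm gap_gt0) => le_C.
apply: le_trans (ler_wpM2r (expR_ge0 _) le_C) _.
have -> : expR (omega * t) = (expR (- omega * t))^-1 by rewrite -expRN mulNr opprK.
by rewrite -mulrA [X in _ * X]mulrAC divff ?mul1r// gt_eqF// expR_gt0.
Qed.
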